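(* The set $\mathscr U$ of all compact ultrametric spaces is path-connected and infinite-dimensional in $\mathscr M$ (that is, with respect to the topology induced by the Gromov–Hausdorff distance).
   Context: $\mathscr M$ is the set of all isometry classes of non-empty compact metric spaces, equipped with the Gromov–Hausdorff distance $\mathcal{GH}$ (the infimum of the Hausdorff distances between $i(X)$ and $j(Y)$ over all isometric embeddings $i:X\to Z$, $j:Y\to Z$ into a common metric space $Z$). $\mathscr U\subset\mathscr M$ is the subset of (isometry classes of) compact ultrametric spaces, where $d$ is an ultrametric if $d(x,y)\le\max\{d(x,z),d(z,y)\}$ for all $x,y,z$. A topological space is infinite-dimensional if its topological (covering) dimension is infinite. *)

(* Defs.v *)
From HB Require Import structures.
From mathcomp Require Import all_boot all_order all_algebra generic_quotient.
From mathcomp Require Import lra.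
From mathcomp Require Import all_classical all_reals all_analysis homotopy.
Set Implicit Arguments.
Unset Strict Implicit.
Unset Printing Implicit Defensive.
Import Order.TTheory GRing.Theory Num.Theory.
Import numFieldNormedType.Exports.
Local Open Scope classical_set_scope.
Local Open Scope ring_scope.
Local Open Scope quotient_scope.

(* Isometry classes can only form a [choiceType], hence a topological space,
   if they are built from carriers living in a universe below that of the
   carriers of [choiceType]; the type of all [metricType R] is too large. This
   record is [metricType R] over its own, smaller universe. That universe still
   contains [R] and its subtypes [{x : R | P x}], hence all cardinalities up to
   the continuum, so no compact metric space is lost up to isometry. *)
Record metricSpace (R : realType) := MetricSpace {
  ms_sort :> Type;
  ms_dist : ms_sort -> ms_sort -> R;
  ms_distxx : forall x, ms_dist x x = 0;
  ms_dist_positivity : forall x y, ms_dist x y = 0 -> x = y;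
  ms_dist_sym : forall x y, ms_dist x y = ms_dist y x;
  ms_dist_triangle : forall y x z, ms_dist x z <= ms_dist x y + ms_dist y z }.

HB.instance Definition _ (R : realType) (X : metricSpace R) :=
  gen_eqMixin (ms_sort X).
HB.instance Definition _ (R : realType) (X : metricSpace R) :=
  gen_choiceMixin (ms_sort X).
HB.instance Definition _ (R : realType) (X : metricSpace R) :=
  isMetric.Build R (ms_sort X) (@ms_distxx R X) (@ms_dist_positivity R X)
    (@ms_dist_sym R X) (@ms_dist_triangle R X).

Record compactMetric (R : realType) := CompactMetric {
  cm_space :> metricSpace R;
  cm_compact : compact [set: cm_space];
  cm_nonempty : [set: cm_space] !=set0 }.

HB.instance Definition _ (R : realType) := gen_eqMixin (compactMetric R).
HB.instance Definition _ (R : realType) := gen_choiceMixin (compactMetric R).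

Section isometries.
Context {R : realType}.
Implicit Types X Y Z : metricType R.

Definition isometric_embedding X Y (f : X -> Y) : Prop :=
  forall x x', mdist (f x) (f x') = mdist x x'.

Definition isometric X Y : Prop :=
  exists2 f : X -> Y, bijective f & isometric_embedding f.

Lemma isometric_refl X : isometric X X.
Proof. by exists id => //; exists id. Qed.

Lemma isometric_sym X Y : isometric X Y -> isometric Y X.
Proof.
move=> [f [g fK gK] fi]; exists g; first by exists f.
by move=> y y'; rewrite -fi !gK.
Qed.

Lemma isometric_trans Y X Z : isometric X Y -> isometric Y Z -> isometric X Z.
Proof.
move=> [f bf fi] [g bg gi]; exists (g \o f); first exact: bij_comp.
by move=> x x' /=; rewrite gi fi.
Qed.

End isometries.

Section hausdorff.
Context {R : realType} {Z : metricType R}.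
Implicit Types (z : Z) (A B : set Z).

Definition set_dist z A : R := inf [set mdist z a | a in A].

Definition hausdorff_dist A B : R :=
  Num.max (sup [set set_dist a B | a in A]) (sup [set set_dist b A | b in B]).

Lemma set_dist_le z A a : A a -> set_dist z A <= mdist z a.
Proof.
move=> Aa; apply: ge_inf; last by exists a.
by exists 0 => _ [b _ <-]; exact: mdist_ge0.
Qed.

Lemma set_dist_ge0 z A : A !=set0 -> 0 <= set_dist z A.
Proof.
move=> [a Aa]; apply: lb_le_inf; first by exists (mdist z a); exists a.
by move=> _ [b _ <-]; exact: mdist_ge0.
Qed.

Lemma set_dist_lt z A (r : R) : A !=set0 -> set_dist z A < r ->
  exists2 a, A a & mdist z a < r.
Proof.
move=> [a Aa] /inf_lt[|_ [b Ab <-] br]; last by exists b.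
by exists (mdist z a); exists a.
Qed.

End hausdorff.

Section gromov_hausdorff.
Context {R : realType}.
Implicit Types X Y W : compactMetric R.

Definition gh_dist X Y : R :=
  inf [set r | exists (Z : metricType R) (i : X -> Z) (j : Y -> Z),
    [/\ isometric_embedding i, isometric_embedding j &
        r = hausdorff_dist (range i) (range j)]].

Lemma cm_bounded X : exists M : R, forall x x' : X, mdist x x' <= M.
Proof.
have [x0 _] := cm_nonempty X.
have /compact_near_coveringP cX := @cm_compact R X.
have [M [_ h]] : \forall M \near +oo, [set: X] `<=` (fun x => mdist x0 x <= M).
  apply: cX => x _; exists (ball x 1, [set M | mdist x0 x + 1 <= M]) => /=.
    by split; [exact: nbhsx_ballx|exact: nbhs_pinfty_ge (num_real _)].
  move=> [y M] /= []; rewrite ballEmdist/= => xy; apply: le_trans.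
  by rewrite (le_trans (metric_triangle _ x _))// lerD2l ltW.
have {}h y : mdist x0 y <= M + 1 by apply: h => //; rewrite ltrDl.
exists ((M + 1) + (M + 1)) => x x'.
by rewrite (le_trans (metric_triangle _ x0 _))// (metric_sym x) lerD.
Qed.

Section glue.
Context {X Y} (c : X -> Y -> R).
Hypothesis c_gt0 : forall x y, 0 < c x y.
Hypothesis c_triangleX : forall x x' y, c x y <= mdist x x' + c x' y.
Hypothesis c_triangleY : forall x y y', c x y <= c x y' + mdist y' y.
Hypothesis triangle_cX : forall x x' y, mdist x x' <= c x y + c x' y.
Hypothesis triangle_cY : forall x y y', mdist y y' <= c x y + c x y'.

Let d (u v : X + Y) : R :=
  match u, v with
  | inl x, inl x' => mdist x x'
  | inl x, inr y => c x y
  | inr y, inl x => c x y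
  | inr y, inr y' => mdist y y'
  end.

Lemma metric_glue : exists (Z : metricType R) (i : X -> Z) (j : Y -> Z),
  [/\ isometric_embedding i, isometric_embedding j &
      forall x y, mdist (i x) (j y) = c x y].
Proof.
have d0 u : d u u = 0 by case: u => u; exact: mdistxx.
have dp u v : d u v = 0 -> u = v.
  case: u v => [x|y] [x'|y'] /=.
  - by move/mdist_positivity ->.
  - by move=> h; have := c_gt0 x y'; rewrite h ltxx.
  - by move=> h; have := c_gt0 x' y; rewrite h ltxx.
  - by move/mdist_positivity ->.
have ds u v : d u v = d v u by case: u v => [x|y] [x'|y'] //=; exact: metric_sym.
have dt v u w : d u w <= d u v + d v w.
  case: u v w => [x|y] [x'|y'] [x''|y''] //=.
  - exact: metric_triangle.
  - by rewrite addrC metric_sym; exact: c_triangleX.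
  - by rewrite metric_sym addrC c_triangleY.
  - exact: metric_triangle.
exists (MetricSpace d0 dp ds dt : metricType R), inl, inr; split => //.
Qed.
End glue.

Lemma hausdorff_dist_le X Y (Z : metricType R) (i : X -> Z) (j : Y -> Z) (r : R) :
  (forall x, exists y, mdist (i x) (j y) <= r) ->
  (forall y, exists x, mdist (i x) (j y) <= r) ->
  hausdorff_dist (range i) (range j) <= r.
Proof.
move=> hX hY; have [x0 _] := cm_nonempty X; have [y0 _] := cm_nonempty Y.
rewrite /hausdorff_dist ge_max; apply/andP; split; apply: ge_sup.
- by exists (set_dist (i x0) (range j)); exists (i x0) => //; exists x0.
- move=> _ [_ [x _ <-] <-]; have [y xy] := hX x.
  by apply: le_trans xy; apply: set_dist_le; exists y.
- by exists (set_dist (j y0) (range i)); exists (j y0) => //; exists y0.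
- move=> _ [_ [y _ <-] <-]; have [x xy] := hY y.
  by apply: le_trans xy; rewrite metric_sym; apply: set_dist_le; exists x.
Qed.

Lemma hausdorff_dist_lt_l X Y (Z : metricType R) (i : X -> Z) (j : Y -> Z)
    (r : R) :
  isometric_embedding i -> hausdorff_dist (range i) (range j) < r ->
  forall x, exists y, mdist (i x) (j y) < r.
Proof.
move=> iemb + x; have [y0 _] := cm_nonempty Y; have [M hM] := cm_bounded X.
rewrite /hausdorff_dist gt_max => /andP[+ _] => hr.
have ir : set_dist (i x) (range j) < r.
  apply: le_lt_trans hr; apply: ub_le_sup; last by exists (i x) => //; exists x.
  exists (M + mdist (i x) (j y0)) => _ [_ [x' _ <-] <-].
  apply: (@le_trans _ _ (mdist (i x') (j y0))).
    by apply: set_dist_le; exists y0.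
  by rewrite (le_trans (metric_triangle _ (i x) _))// lerD2r iemb.
by have [|_ [y _ <-] ?] := set_dist_lt _ ir; [exists (j y0); exists y0|exists y].
Qed.

Lemma hausdorff_distC (Z : metricType R) (A B : set Z) :
  hausdorff_dist A B = hausdorff_dist B A.
Proof. by rewrite /hausdorff_dist maxC. Qed.

Lemma hausdorff_dist_lt_r X Y (Z : metricType R) (i : X -> Z) (j : Y -> Z)
    (r : R) :
  isometric_embedding j -> hausdorff_dist (range i) (range j) < r ->
  forall y, exists x, mdist (i x) (j y) < r.
Proof.
move=> jemb; rewrite hausdorff_distC => /(hausdorff_dist_lt_l jemb) h y.
by have [x] := h y; rewrite metric_sym; exists x.
Qed.

Let ge0_sup (S : set R) : (forall x, S x -> 0 <= x) -> 0 <= sup S.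
Proof.
move=> S0; have [hS|/sup_out->//] := pselect (has_sup S).
have [[x Sx] ubS] := hS.
by rewrite (le_trans (S0 _ Sx))//; exact: ub_le_sup.
Qed.

Lemma hausdorff_dist_ge0 X Y (Z : metricType R) (i : X -> Z) (j : Y -> Z) :
  0 <= hausdorff_dist (range i) (range j).
Proof.
rewrite /hausdorff_dist le_max; apply/orP; left.
apply: ge0_sup => _ [_ [x _ <-] <-]; apply: set_dist_ge0.
by have [y0 _] := cm_nonempty Y; exists (j y0); exists y0.
Qed.

Lemma gh_dist_le X Y (Z : metricType R) (i : X -> Z) (j : Y -> Z) (r : R) :
  isometric_embedding i -> isometric_embedding j ->
  (forall x, exists y, mdist (i x) (j y) <= r) ->
  (forall y, exists x, mdist (i x) (j y) <= r) ->
  gh_dist X Y <= r.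
Proof.
move=> iemb jemb hX hY; apply: le_trans (hausdorff_dist_le hX hY).
apply: ge_inf; last by exists Z, i, j.
exists 0 => _ [Z' [i' [j' [_ _ ->]]]].
exact: hausdorff_dist_ge0.
Qed.

Lemma gh_dist_nonempty X Y : [set r | exists (Z : metricType R) (i : X -> Z) (j : Y -> Z),
    [/\ isometric_embedding i, isometric_embedding j &
        r = hausdorff_dist (range i) (range j)]] !=set0.
Proof.
have [M hM] := cm_bounded X; have [N hN] := cm_bounded Y.
pose D := 1 + `|M| + `|N|.
have XD (x x' : X) : mdist x x' <= D.
  by rewrite (le_trans (hM _ _))// (le_trans (ler_norm _))// /D addrAC lerDr addr_ge0.
have YD (y y' : Y) : mdist y y' <= D.
  by rewrite (le_trans (hN _ _))// (le_trans (ler_norm _))// /D lerDr addr_ge0.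
have D0 : 0 < D by rewrite /D -addrA ltr_wpDr// addr_ge0.
have [|x x' _|_ y y'|x x' _|_ y y'|Z [i [j [iemb jemb _]]]] :=
    @metric_glue X Y (fun _ _ => D).
- by [].
- by rewrite lerDr mdist_ge0.
- by rewrite lerDl mdist_ge0.
- by rewrite (le_trans (XD _ _))// lerDl ltW.
- by rewrite (le_trans (YD _ _))// lerDl ltW.
by exists (hausdorff_dist (range i) (range j)); exists Z, i, j.
Qed.

Lemma gh_dist_ltP X Y (r : R) : gh_dist X Y < r ->
  exists (Z : metricType R) (i : X -> Z) (j : Y -> Z),
    [/\ isometric_embedding i, isometric_embedding j,
        forall x, exists y, mdist (i x) (j y) < r &
        forall y, exists x, mdist (i x) (j y) < r].
Proof.
move=> /inf_lt[|_ [Z [i [j [iemb jemb ->]]]] hr]; first exact: gh_dist_nonempty.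
exists Z, i, j; split => //; first exact: hausdorff_dist_lt_l.
exact: hausdorff_dist_lt_r.
Qed.

Lemma gh_distC X Y : gh_dist X Y = gh_dist Y X.
Proof.
congr inf; apply/seteqP; split=> r [Z [i [j [iemb jemb ->]]]];
  by exists Z, j, i; split => //; exact: hausdorff_distC.
Qed.

Lemma gh_dist_ge0 X Y : 0 <= gh_dist X Y.
Proof.
apply: lb_le_inf; first exact: gh_dist_nonempty.
by move=> _ [Z' [i' [j' [_ _ ->]]]]; exact: hausdorff_dist_ge0.
Qed.

Lemma isometric_gh_dist X Y : isometric X Y -> gh_dist X Y = 0.
Proof.
move=> [f [g fK gK] fi]; apply/eqP; rewrite eq_le gh_dist_ge0 andbT.
apply: (@gh_dist_le X Y Y f id) => // [x|y].
  by exists (f x); rewrite mdistxx.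
by exists (g y); rewrite gK mdistxx.
Qed.

Lemma gh_dist_triangle Y X W : gh_dist X W <= gh_dist X Y + gh_dist Y W.
Proof.
apply/ler_addgt0Pl => e e0.
have e3 : 0 < e / 3 by rewrite divr_gt0.
have [|Z [i [j [iemb jemb hX hY]]]] := @gh_dist_ltP X Y (gh_dist X Y + e / 3).
  by rewrite ltrDl.
have [|Z' [k [l [kemb lemb hY' hW]]]] := @gh_dist_ltP Y W (gh_dist Y W + e / 3).
  by rewrite ltrDl.
pose S x w := [set mdist (i x) (j y) + mdist (k y) (l w) | y in [set: Y]].
have [y0 _] := cm_nonempty Y.
have S0 x w : S x w !=set0 by exists (mdist (i x) (j y0) + mdist (k y0) (l w)); exists y0.
have Slb x w : lbound (S x w) 0.
  by move=> _ [y _ <-]; rewrite addr_ge0 ?mdist_ge0.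
have Sge x w y : inf (S x w) <= mdist (i x) (j y) + mdist (k y) (l w).
  by apply: ge_inf; [exists 0|exists y].
have Sinf x w (r : R) : (forall y, r <= mdist (i x) (j y) + mdist (k y) (l w)) ->
    r <= inf (S x w).
  by move=> h; apply: lb_le_inf => // _ [y _ <-].
have tr := @metric_triangle R.
have Sapx x w (r : R) : 0 < r -> exists y, mdist (i x) (j y) + mdist (k y) (l w) < inf (S x w) + r.
  move=> r0; have [|_ [y _ <-] h] := @inf_adherent _ (S x w) r r0; last by exists y.
  by split => //; exists 0.
pose c x w := e / 3 + inf (S x w).
have [|x x' w|x w w'|x x' w|x w w'|V [a [b [aemb bemb ab]]]] := @metric_glue X W c.
- by move=> x w; rewrite /c ltr_wpDr// Sinf// => y; rewrite addr_ge0 ?mdist_ge0.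
- rewrite /c addrCA lerD2l -lerBlDl; apply: Sinf => y; rewrite lerBlDl.
  rewrite (le_trans (Sge x w y))// addrA lerD2r -iemb; exact: tr.
- rewrite /c -addrA lerD2l -lerBlDr; apply: Sinf => y; rewrite lerBlDr.
  rewrite (le_trans (Sge x w y))// -addrA lerD2l -lemb; exact: tr.
- have [y hy] := Sapx x w _ e3; have [y' hy'] := Sapx x' w _ e3.
  have := tr _ (i x) (j y) (i x'); have := tr _ (j y) (j y') (i x').
  have := tr _ (k y) (l w) (k y'); rewrite iemb jemb kemb.
  rewrite (metric_sym (j y')) (metric_sym (l w)) /c; lra.
- have [y hy] := Sapx x w _ e3; have [y' hy'] := Sapx x w' _ e3.
  have := tr _ (l w) (k y) (l w'); have := tr _ (k y) (k y') (l w').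
  have := tr _ (j y) (i x) (j y'); rewrite lemb jemb kemb.
  rewrite (metric_sym (j y)) (metric_sym (l w)) /c; lra.
apply: (gh_dist_le aemb bemb) => [x|w].
- have [y hy] := hX x; have [w hw] := hY' y; exists w.
  by rewrite ab /c; have := Sge x w y; lra.
- have [y hy] := hW w; have [x hx] := hY y; exists x.
  by rewrite ab /c; have := Sge x w y; lra.
Qed.

Lemma gh_dist0_approx X Y (e : R) : gh_dist X Y = 0 -> 0 < e ->
  exists (f : X -> Y) (g : Y -> X),
    [/\ forall x x', `|mdist (f x) (f x') - mdist x x'| <= e,
        forall y y', `|mdist (g y) (g y') - mdist y y'| <= e,
        forall x, mdist (g (f x)) x <= e & forall y, mdist (f (g y)) y <= e].
Proof.
move=> XY e0; have e2 : 0 < e / 2 by rewrite divr_gt0.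
have [|Z [i [j [iemb jemb]]]] := @gh_dist_ltP X Y (e / 2); first by rewrite XY.
move=> /choice[f hf] /choice[g hg]; exists f, g.
have tr := @metric_triangle R Z.
split=> [x x'|y y'|x|y].
- rewrite -iemb -jemb ler_norml; apply/andP; split.
    have := tr (i x) (j (f x)) (i x'); have := tr (j (f x)) (j (f x')) (i x').
    by rewrite (metric_sym (j (f x')) (i x')); have := hf x; have := hf x'; lra.
  have := tr (j (f x)) (i x) (j (f x')); have := tr (i x) (i x') (j (f x')).
  by rewrite (metric_sym (j (f x)) (i x)); have := hf x; have := hf x'; lra.
- rewrite -iemb -jemb ler_norml; apply/andP; split.
    have := tr (j y) (i (g y)) (j y'); have := tr (i (g y)) (i (g y')) (j y').
    by rewrite (metric_sym (j y) (i (g y))); have := hg y; have := hg y'; lra.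
  have := tr (i (g y)) (j y) (i (g y')); have := tr (j y) (j y') (i (g y')).
  by rewrite (metric_sym (j y') (i (g y'))); have := hg y; have := hg y'; lra.
- rewrite -iemb; have := tr (i (g (f x))) (j (f x)) (i x).
  rewrite (metric_sym (j (f x)) (i x)).
  by have := hf x; have := hg (f x); lra.
- rewrite -jemb; have := tr (j (f (g y))) (i (g y)) (j y).
  rewrite (metric_sym (j (f (g y))) (i (g y))).
  by have := hf (g y); have := hg y; lra.
Qed.

Lemma gh_dist0_isometric X Y : gh_dist X Y = 0 -> isometric X Y.
Proof.
move=> XY.
pose e_ n : R := n.+1%:R^-1.
have e_gt0 n : 0 < e_ n by rewrite invr_gt0.
have /choice[f_ /choice[g_ fg]] n := gh_dist0_approx XY (e_gt0 n).
have [U [UU ooU]] := ultraFilterLemma eventually_filter.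
have Ue (e : R) : 0 < e -> \forall n \near U, e_ n <= e.
  move=> e0; apply: ooU; apply: filterS (near_infty_natSinv_lt (PosNum e0)) => n.
  exact: ltW.
have limU (W : compactMetric R) (u : nat -> W) : exists w, forall e : R, 0 < e ->
    \forall n \near U, mdist (u n) w <= e.
  have [|w [_ uw]] := @cm_compact R W (u @ U) _; first exact: filterT.
  exists w => e e0; have [//|Ule] := in_ultra_setVsetC [set n | mdist (u n) w <= e] UU.
  have [z []] := uw (~` [set z | mdist z w <= e]) (ball w e) Ule (nbhsx_ballx _ _ e0).
  by rewrite ballEmdist/= metric_sym => + /ltW.
have /choice[f hf] x := limU Y (f_ ^~ x).
have /choice[g hg] y := limU X (g_ ^~ y).
have le_eps (a b : R) : (forall e, 0 < e -> `|a - b| <= 4 * e) -> a = b.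
  move=> h; apply/eqP; rewrite -subr_eq0 -normr_le0; apply/ler_addgt0Pl => e e0.
  by have := h (e / 4); rewrite divr_gt0// => /(_ isT); lra.
have Uex (P : nat -> Prop) : (\forall n \near U, P n) -> exists n, P n.
  exact: filter_ex.
exists f; first exists g.
- move=> x; apply: mdist_positivity; apply: le_eps => e e0.
  rewrite subr0 ger0_norm ?mdist_ge0//.
  have [n [en fx gx]] : exists n, [/\ e_ n <= e, mdist (f_ n x) (f x) <= e &
      mdist (g_ n (f x)) (g (f x)) <= e].
    by apply: Uex; apply: filterS3 (Ue _ e0) (hf x _ e0) (hg (f x) _ e0) => n.
  have [_ /(_ (f x) (f_ n x)) + /(_ x) + _] := fg n; rewrite ler_norml.
  have := metric_triangle (g (f x)) (g_ n (f x)) x.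
  have := metric_triangle (g_ n (f x)) (g_ n (f_ n x)) x.
  rewrite (metric_sym (g (f x)) (g_ n (f x))) (metric_sym (f x) (f_ n x)).
  by move=> t1 t2 /andP[? ?] ?; lra.
- move=> y; apply: mdist_positivity; apply: le_eps => e e0.
  rewrite subr0 ger0_norm ?mdist_ge0//.
  have [n [en gy fy]] : exists n, [/\ e_ n <= e, mdist (g_ n y) (g y) <= e &
      mdist (f_ n (g y)) (f (g y)) <= e].
    by apply: Uex; apply: filterS3 (Ue _ e0) (hg y _ e0) (hf (g y) _ e0) => n.
  have [/(_ (g y) (g_ n y)) + _ _ /(_ y)] := fg n; rewrite ler_norml.
  have := metric_triangle (f (g y)) (f_ n (g y)) y.
  have := metric_triangle (f_ n (g y)) (f_ n (g_ n y)) y.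
  rewrite (metric_sym (f (g y)) (f_ n (g y))) (metric_sym (g y) (g_ n y)).
  by move=> t1 t2 /andP[? ?] ?; lra.
- move=> x x'; apply: le_eps => e e0.
  have [n [en fx fx']] : exists n, [/\ e_ n <= e, mdist (f_ n x) (f x) <= e & mdist (f_ n x') (f x') <= e].
    by apply: Uex; apply: filterS3 (Ue _ e0) (hf x _ e0) (hf x' _ e0) => n.
  have [/(_ x x') + _ _ _] := fg n.
  have := metric_triangle (f x) (f_ n x) (f x'); have := metric_triangle (f_ n x) (f_ n x') (f x').
  have := metric_triangle (f_ n x) (f x) (f_ n x'); have := metric_triangle (f x) (f x') (f_ n x').
  rewrite (metric_sym (f x) (f_ n x)) (metric_sym (f x') (f_ n x')) !ler_norml.
  move=> t1 t2 t3 t4 /andP[? ?]; apply/andP; split; lra.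
Qed.

End gromov_hausdorff.

Section isometry_classes.
Variable R : realType.
Implicit Types X Y W : compactMetric R.

Definition isometricb X Y : bool := `[< isometric X Y >].

Let isometricb_refl : reflexive isometricb.
Proof. by move=> X; exact/asboolP/isometric_refl. Qed.

Let isometricb_sym : symmetric isometricb.
Proof. by move=> X Y; apply/asboolP/asboolP; exact: isometric_sym. Qed.

Let isometricb_trans : transitive isometricb.
Proof.
move=> Y X W /asboolP XY /asboolP YW.
by apply/asboolP; exact: isometric_trans YW.
Qed.

Definition isometry_rel :=
  EquivRel isometricb isometricb_refl isometricb_sym isometricb_trans.

Definition ghSpace : Type := {eq_quot isometry_rel}.
HB.instance Definition _ := Choice.on ghSpace.
HB.instance Definition _ := Quotient.on ghSpace.

Lemma pi_ghSpaceP X Y : \pi_ghSpace X = \pi_ghSpace Y <-> isometric X Y.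
Proof.
split=> [/eqmodP /asboolP//|XY].
by apply/eqmodP; exact/asboolP.
Qed.

Lemma isometric_repr_pi X : isometric (repr (\pi_ghSpace X) : compactMetric R) X.
Proof. by apply/pi_ghSpaceP; rewrite reprK. Qed.

Implicit Types a b : ghSpace.

Definition gh_class_dist a b : R := gh_dist (repr a) (repr b).

Let gh_class_distxx a : gh_class_dist a a = 0.
Proof. exact/isometric_gh_dist/isometric_refl. Qed.

Let gh_class_dist_positivity a b : gh_class_dist a b = 0 -> a = b.
Proof.
by move=> /gh_dist0_isometric/pi_ghSpaceP; rewrite !reprK.
Qed.

Let gh_class_distC a b : gh_class_dist a b = gh_class_dist b a.
Proof. exact: gh_distC. Qed.

Let gh_class_dist_triangle b a c :
  gh_class_dist a c <= gh_class_dist a b + gh_class_dist b c.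
Proof. exact: gh_dist_triangle. Qed.

HB.instance Definition _ := isMetric.Build R ghSpace gh_class_distxx
  gh_class_dist_positivity gh_class_distC gh_class_dist_triangle.

Lemma mdist_pi X Y : mdist (\pi_ghSpace X) (\pi_ghSpace Y) = gh_dist X Y.
Proof.
rewrite -[LHS]/(gh_class_dist _ _) /gh_class_dist.
set X' : compactMetric R := repr _; set Y' : compactMetric R := repr _.
have X'0 : gh_dist X' X = 0 by exact/isometric_gh_dist/isometric_repr_pi.
have Y'0 : gh_dist Y' Y = 0 by exact/isometric_gh_dist/isometric_repr_pi.
apply/eqP; rewrite eq_le; apply/andP; split.
  have t1 := gh_dist_triangle X X' Y'; have t2 := gh_dist_triangle Y X Y'.
  by rewrite (gh_distC Y Y') Y'0 in t2; rewrite X'0 in t1; lra.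
have t1 := gh_dist_triangle X' X Y; have t2 := gh_dist_triangle Y' X' Y.
by rewrite Y'0 in t2; rewrite (gh_distC X X') X'0 in t1; lra.
Qed.

End isometry_classes.

Definition ultrametric (R : realType) (X : metricType R) : Prop :=
  forall x y z : X, mdist x y <= Num.max (mdist x z) (mdist z y).

Definition ultrametric_classes (R : realType) : set (ghSpace R) :=
  [set \pi_(ghSpace R) X | X in [set X : compactMetric R | ultrametric X]].

Section unit_interval.
Variable R : realType.

Definition unit_interval : Type := set_type (`[0, 1] : set R).
HB.instance Definition _ := Topological.on unit_interval.

Let zero_itv : (0 : R) \in (`[0, 1]%classic : set R).
Proof. by rewrite inE /= in_itv /= lexx ler01. Qed.

Let one_itv : (1 : R) \in (`[0, 1]%classic : set R).
Proof. by rewrite inE /= in_itv /= lexx ler01. Qed.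

Let zero_one_neq : SigSub zero_itv != SigSub one_itv :> unit_interval.
Proof. by apply/eqP => /(congr1 val) /= /eqP; rewrite eq_sym oner_eq0. Qed.

HB.instance Definition _ := isBiPointed.Build unit_interval zero_one_neq.

End unit_interval.

Definition path_connected (R : realType) (T : topologicalType) : Prop :=
  forall x y : T, squashed {path unit_interval R from x to y in T}.

Section covering_dimension.
Implicit Types T : topologicalType.

Definition open_cover T (I : finType) (U : I -> set T) : Prop :=
  (forall i, open (U i)) /\ \bigcup_i U i = [set: T].

Definition refines T (I J : finType) (V : J -> set T) (U : I -> set T) : Prop :=
  forall j, exists i, V j `<=` U i.

(* Cech-Lebesgue dimension: every finite open cover has a finite open
   refinement in which no point lies in more than n + 1 members. *)
Definition covering_dim_le T (n : nat) : Prop :=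
  forall (I : finType) (U : I -> set T), open_cover U ->
  exists (J : finType) (V : J -> set T),
    [/\ open_cover V, refines V U &
        forall x, (#|[set j | `[< V j x >]]%SET| <= n.+1)%N].

Definition infinite_dimensional T : Prop := forall n, ~ covering_dim_le T n.

End covering_dimension.

(* Main.v *)
Require Import Defs.
From mathcomp Require Import all_boot all_order all_algebra.
From mathcomp Require Import all_classical all_reals all_analysis.
From mathcomp Require Import generic_quotient zify lra homotopy.

(** Path-connectedness. Given compact ultrametric spaces [X] and [Y], the product
    [X * Y] with the distance [max ((1 - t) dX) (t dY)] is a compact ultrametric
    space for [0 < t < 1], and the same formula describes [X] for [t = 0] and
    [Y] for [t = 1] after identifying points at distance zero. All these spaces
    are parametrized by [X * Y], with distances that are Lipschitz in [t]; so
    by [gh_dist_correspondence] they form a continuous path from [X] to [Y].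

    Infinite dimension. To [x] in the standard simplex with [n + 2] vertices one
    associates the finite ultrametric space in which distinct points [u] and [v]
    are at distance [max (a u) (a v)], where [a 0 = 0] and
    [a (k + 1) = 2 k + 1 + x_k]. The class of this space depends continuously on
    [x], and determines [x] because the set of distances does. So the simplex,
    of dimension [n + 1], embeds into the space of ultrametric classes, as a
    closed subset by compactness. It remains to see that the cover of the
    simplex by the complements of its facets has no finite open refinement of
    multiplicity at most [n + 1]; merging the members of such a refinement, this
    is the theorem of Knaster, Kuratowski and Mazurkiewicz ([kkm_open]): [n + 2]
    open sets that cover the simplex, the [i]-th one disjoint from the [i]-th
    facet, have a common point.

    That theorem follows from Sperner's lemma ([sperner]) on iterated barycentric
    subdivisions. Simplices are lists of vertices and chains modulo 2 are lists
    of simplices; subdivision is defined by coning, so that no combinatorial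
    description of the triangulation is needed: Sperner's lemma only uses that
    subdivision is a chain map ([cobd_subdiv]), and the mesh estimate
    ([subdiv_mesh]) is an induction along the same cones. *)

Set Implicit Arguments.
Unset Strict Implicit.
Unset Printing Implicit Defensive.
Import Order.TTheory GRing.Theory Num.Theory.
Import numFieldNormedType.Exports.
Local Open Scope classical_set_scope.
Local Open Scope ring_scope.
Local Open Scope quotient_scope.

(** * Sperner's lemma for iterated subdivisions *)

(** The list of the faces of an ordered simplex [s], given by its list of
    vertices: the lists obtained by deleting one vertex. The only face of a
    point is the empty simplex, so that chains are augmented. *)
Fixpoint faces (T : Type) (s : seq T) {struct s} : seq (seq T) :=
  if s is v :: s' then s' :: [seq v :: t | t <- faces s'] else [::].

Section chains.
Variable V : eqType.
Implicit Types (s t : seq V) (F : seq V -> bool).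

Lemma size_faces s t : t \in faces s -> size s = (size t).+1.
Proof.
elim: s t => [//|v s IH] t /=; rewrite inE => /orP[/eqP->//|].
by move=> /mapP[u /IH su ->]; rewrite /= su.
Qed.

Lemma mem_faces s t : t \in faces s -> {subset t <= s}.
Proof.
elim: s t => [//|v s IH] t /=; rewrite inE => /orP[/eqP->|].
  by move=> x xs; rewrite inE xs orbT.
move=> /mapP[u /IH su ->] x; rewrite !inE => /orP[->//|/su->].
by rewrite orbT.
Qed.

(** The coboundary, modulo 2, of a cochain [F] on ordered simplices. Chain
    identities are stated below through their pairing with cochains; the sums
    are taken in [bool], that is, in the field with two elements. *)
Definition cobd F s : bool := \sum_(t <- faces s) F t.

Lemma cobd_cons F v s : cobd F (v :: s) = F s + cobd (F \o cons v) s.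
Proof. by rewrite /cobd /= big_cons big_map. Qed.

Lemma cobd_add F G s : cobd (fun t => F t + G t) s = cobd F s + cobd G s.
Proof. by rewrite /cobd big_split. Qed.

Lemma cobd_cobd F s : cobd (cobd F) s = false.
Proof.
elim: s F => [|v s IH] F; first by rewrite /cobd /= big_nil.
rewrite cobd_cons.
have -> : cobd (cobd F \o cons v) s = cobd F s + cobd (cobd (F \o cons v)) s.
  rewrite -cobd_add; apply: eq_bigr => t _; exact: cobd_cons.
by rewrite IH addr0; exact: addbb.
Qed.

Variable b : seq V -> V.

(** Subdivision of a simplex [s] with [n] vertices, by coning from the point
    [b s] the subdivisions of the faces of [s]; it is the barycentric
    subdivision when [b s] is the barycentre of [s]. *)
Fixpoint subdiv n s : seq (seq V) :=
  if n is n'.+1 then [seq b s :: u | t <- faces s, u <- subdiv n' t]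
  else [:: [::]].

(** Subdivision is a chain map, modulo 2. Indeed the boundary of a cone is its
    base plus the cone on the boundary of the base, and here the base is the
    subdivision of a boundary, so that its boundary vanishes. *)
Lemma cobd_subdiv F n s : size s = n.+1 ->
  \sum_(t <- subdiv n.+1 s) cobd F t =
  \sum_(t <- faces s) \sum_(u <- subdiv n t) F u.
Proof.
elim: n F s => [|n IH] F s ss.
  case: s ss => [//|v [|//]] _.
  by rewrite /= !big_cons !big_nil /cobd /= !(big_cons,big_nil).
rewrite [subdiv _ _]/= big_allpairs_dep.
transitivity (\sum_(t <- faces s) (\sum_(u <- subdiv n.+1 t) F u
   + cobd (fun r => \sum_(u <- subdiv n r) F (b s :: u)) t)).
  rewrite [LHS]big_seq [RHS]big_seq; apply: eq_bigr => t ts.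
  under eq_bigr do rewrite cobd_cons.
  rewrite big_split; congr (_ + _); rewrite IH //.
  by have := size_faces ts; rewrite ss => -[].
by rewrite big_split /= -[X in _ + X]/(cobd (cobd _) s) cobd_cobd addr0.
Qed.

(** Subdivision iterated [r] times. *)
Fixpoint isubdiv r n s : seq (seq V) :=
  if r is r'.+1 then [seq u | t <- subdiv n s, u <- isubdiv r' n t]
  else [:: s].

Lemma size_subdiv n s t : t \in subdiv n s -> size t = n.
Proof.
elim: n s t => [|n IH] s t; first by rewrite inE => /eqP->.
by move=> /allpairsPdep[u [w [_ /IH sw ->]]] /=; rewrite sw.
Qed.

Lemma cobd_isubdiv F r n s : size s = n.+1 ->
  \sum_(t <- isubdiv r n.+1 s) cobd F t =
  \sum_(t <- faces s) \sum_(u <- isubdiv r n t) F u.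
Proof.
elim: r F s => [|r IH] F s ss.
  by rewrite big_seq1; apply: eq_bigr => t _; rewrite big_seq1.
rewrite big_allpairs_dep.
transitivity (\sum_(t <- subdiv n.+1 s)
    cobd (fun t => \sum_(u <- isubdiv r n t) F u) t).
  rewrite [LHS]big_seq [RHS]big_seq; apply: eq_bigr => t ts.
  by rewrite IH// (size_subdiv ts).
rewrite cobd_subdiv//; apply: eq_bigr => t _.
by rewrite big_allpairs_dep.
Qed.

(** A property of points that passes to the barycentres holds at the vertices
    of the subdivision as soon as it holds at those of the simplex. *)
Lemma subdiv_closed (S : V -> Prop) n s :
  (forall t, t != [::] -> (forall v, v \in t -> S v) -> S (b t)) ->
  size s = n -> (forall v, v \in s -> S v) ->
  forall t, t \in subdiv n s -> forall v, v \in t -> S v.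
Proof.
move=> Sb; elim: n s => [|n IH] s ss sS t; first by rewrite inE => /eqP->.
move=> /allpairsPdep[u [w [us wu ->]]] v; rewrite inE => /orP[/eqP->|].
  by apply: Sb => //; rewrite -size_eq0 ss.
apply: (IH u) => //; first by have := size_faces us; rewrite ss => -[].
by move=> x /(mem_faces us); exact: sS.
Qed.

Lemma isubdiv_closed (S : V -> Prop) r n s :
  (forall t, t != [::] -> (forall v, v \in t -> S v) -> S (b t)) ->
  size s = n -> (forall v, v \in s -> S v) ->
  forall t, t \in isubdiv r n s -> forall v, v \in t -> S v.
Proof.
move=> Sb; elim: r s => [|r IH] s ss sS t; first by rewrite inE => /eqP->.
move=> /allpairsPdep[u [w [us wu ->]]].
apply: (IH u) => //; first exact: size_subdiv us.
exact: subdiv_closed us.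
Qed.

End chains.

(** Deleting an occurrence of [x] in [s] gives a permutation of [A] if and only
    if [s] is a permutation of [x :: A]; the prefix [p] is for the induction. *)
Lemma sum_faces_perm (T : eqType) (p s A : seq T) :
  \sum_(t <- faces s) perm_eq (p ++ t) A =
  \sum_(x <- s) perm_eq (p ++ s) (x :: A) :> bool.
Proof.
elim: s p => [|v s IH] p /=; first by rewrite !big_nil.
rewrite !big_cons big_map; congr (_ + _).
  by rewrite -cat1s perm_catCA perm_cons.
under eq_bigr do rewrite -cat_rcons.
by rewrite IH; apply: eq_bigr => x _; rewrite cat_rcons.
Qed.

(** Among the faces of a simplex with vertices labelled in [0 .. k], an odd
    number carry exactly the labels [0 .. k-1] if and only if the simplex
    carries exactly the labels [0 .. k]. *)
Lemma sum_faces_iota (k : nat) (s : seq nat) : all (fun x => x <= k)%N s ->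
  \sum_(t <- faces s) perm_eq t (iota 0 k) = perm_eq s (iota 0 k.+1) :> bool.
Proof.
move=> sk; rewrite (sum_faces_perm [::]) /=.
have ik : perm_eq (iota 0 k.+1) (k :: iota 0 k).
  by rewrite -addn1 iotaD add0n cats1 perm_rcons.
rewrite (permPr ik).
have [/hasP[y ys sy]|/hasPn no] :=
    boolP (has (fun y => perm_eq s (y :: iota 0 k)) s); last first.
  have -> : perm_eq s (k :: iota 0 k) = false.
    by apply/negP => p; have := no k; rewrite (perm_mem p) mem_head p => /(_ isT).
  by rewrite big_seq big1 // => x /no/negbTE ->.
(* the labels of [s] are [0 .. k-1] and [y]; deleting any copy of [y] works *)
have e x : perm_eq s (x :: iota 0 k) = (x == y).
  rewrite (permPl sy) -cat1s -[x :: _]cat1s perm_cat2r.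
  by apply/idP/eqP => [/perm_mem/(_ y)|->]; rewrite // !inE eqxx => /esym/eqP.
under eq_bigr do rewrite e.
rewrite e (perm_big _ sy)/= big_cons eqxx big_seq.
have yk : (y <= k)%N by exact: (allP sk).
have [<-|ky] := eqVneq k y.
  by rewrite big1 // => i; rewrite mem_iota add0n => /andP[_ /ltn_eqF ->].
rewrite -big_seq (bigD1_seq y) ?iota_uniq ?mem_iota//=; last first.
  by rewrite add0n ltn_neqAle eq_sym ky.
by rewrite eqxx big1 // => i /negbTE ->.
Qed.

Lemma faces_map (T U : Type) (f : T -> U) (s : seq T) :
  faces (map f s) = map (map f) (faces s).
Proof. by elim: s => //= v s ->; rewrite -!map_comp. Qed.

Lemma faces_rcons (T : Type) (s : seq T) (v : T) :
  faces (rcons s v) = rcons [seq rcons t v | t <- faces s] s.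
Proof. by elim: s => //= w s ->; rewrite map_rcons -!map_comp. Qed.

(** Sperner's lemma. The points [e 0 .. e (N-1)] are the vertices of the big
    simplex [D], and [Z i] is the face opposite to [e i]; a label [l x] is
    admissible if [x] is not on the face [Z (l x)]. *)
Section sperner.
Variables (V : eqType) (b : seq V -> V) (N : nat) (e : nat -> V) (l : V -> nat).
Variables (D : V -> Prop) (Z : nat -> V -> Prop).
Hypothesis Db : forall t, t != [::] -> (forall v, v \in t -> D v) -> D (b t).
Hypothesis Zb : forall i t, t != [::] ->
  (forall v, v \in t -> Z i v) -> Z i (b t).
Hypothesis De : forall j, (j < N)%N -> D (e j).
Hypothesis Ze : forall i j, (j < N)%N -> i != j -> Z i (e j).
Hypothesis lZ : forall x, D x -> ~ Z (l x) x.

Lemma sperner_label r n (u : seq nat) j : size u = n ->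
  (forall i, i \in u -> (i < N)%N) -> j \notin u ->
  forall t, t \in isubdiv b r n (map e u) -> j \notin map l t.
Proof.
move=> su uN ju t ts; apply/mapP => -[x xt jE].
have ss : size (map e u) = n by rewrite size_map.
have xD : D x.
  by apply: (isubdiv_closed Db ss _ ts xt) => _ /mapP[i /uN iN ->]; exact: De.
apply: (lZ xD); rewrite -jE.
apply: (isubdiv_closed (@Zb j) ss _ ts xt) => _ /mapP[i iu ->].
by apply: Ze; [exact: uN|apply: contraNneq ju => ->].
Qed.

(** By induction on the dimension: by [sum_faces_iota] and [cobd_isubdiv], the
    number of fully labelled simplices of the subdivision has the parity of the
    number of simplices labelled [0 .. k-1] on its boundary, and these lie on
    the face with vertices [e 0 .. e (k-1)]. *)
Lemma sperner_odd r k : (k <= N)%N ->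
  \sum_(t <- isubdiv b r k (map e (iota 0 k))) perm_eq (map l t) (iota 0 k) =
  true.
Proof.
elim: k => [|k IH] kN.
  have -> : isubdiv b r 0 (map e (iota 0 0)) = [:: [::]] by elim: r => //= r ->.
  by rewrite big_seq1.
have se : size (map e (iota 0 k.+1)) = k.+1 by rewrite size_map size_iota.
transitivity (\sum_(t <- isubdiv b r k.+1 (map e (iota 0 k.+1)))
    cobd (fun u => perm_eq (map l u) (iota 0 k)) t).
  rewrite [LHS]big_seq [RHS]big_seq; apply: eq_bigr => t ts.
  rewrite -sum_faces_iota; first by rewrite faces_map big_map.
  apply/allP => i it; rewrite leqNgt; apply/negP => ki.
  move: it; apply/negP.
  apply: (@sperner_label r k.+1 (iota 0 k.+1) i) ts; first by rewrite size_iota.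
    by move=> j; rewrite mem_iota => /andP[_ /leq_trans]; apply.
  by rewrite mem_iota /= add0n ltnS -ltnNge.
rewrite (cobd_isubdiv _ _ _ se).
have ik : iota 0 k.+1 = rcons (iota 0 k) k by rewrite -addn1 iotaD add0n cats1.
rewrite ik map_rcons faces_rcons -cats1 big_cat big_seq1 IH ?(ltnW kN)//.
rewrite big_seq big1 ?add0r// => _ /mapP[t ts ->].
move: ts; rewrite faces_map => /mapP[u us ->].
have [j jk ju] : exists2 j, j \in iota 0 k & j \notin u.
  apply/hasP; apply: contraT => /hasPn no.
  have sub : {subset iota 0 k <= u} by move=> j /no /negPn.
  have := uniq_leq_size (iota_uniq 0 k) sub.
  by rewrite (size_faces us) ltnn.
rewrite -map_rcons big_seq big1// => w ws; apply/negbTE/negP => /perm_mem/(_ j).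
rewrite jk; apply/negP.
apply: (@sperner_label r k (rcons u k) j) ws.
- by rewrite size_rcons -(size_faces us) size_iota.
- move=> i; rewrite mem_rcons inE => /orP[/eqP->//|/(mem_faces us)].
  by rewrite mem_iota => /andP[_ /leq_trans->//]; exact: ltnW.
- rewrite mem_rcons inE negb_or ju andbT neq_ltn.
  by move: jk; rewrite mem_iota add0n => /andP[_ ->].
Qed.

(** Some simplex of the subdivision carries all the labels. *)
Lemma sperner r : exists2 t, t \in isubdiv b r N (map e (iota 0 N)) &
  perm_eq (map l t) (iota 0 N).
Proof.
apply/hasP; apply: contraT => /hasPn no.
by have := sperner_odd r (leqnn N); rewrite big_seq big1 // => t /no/negbTE ->.
Qed.

End sperner.

(** * Mesh of barycentric subdivisions *)

Section mesh.
Context {R : realFieldType} {V : normedModType R}.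
Implicit Types (s t : seq V) (v w z : V) (c D : R).

(** The barycentre of a nonempty list of points. *)
Definition mean s : V := (size s)%:R^-1 *: \sum_(v <- s) v.

Let size_neq0 s : s != [::] -> (size s)%:R != 0 :> R.
Proof. by rewrite pnatr_eq0 size_eq0. Qed.

Lemma mean_subr s z : s != [::] ->
  mean s - z = (size s)%:R^-1 *: \sum_(v <- s) (v - z).
Proof.
move=> s0; rewrite sumrB big_const_seq count_predT iter_addr_0 scalerBr.
by rewrite -(scaler_nat _ z) scalerA mulVf ?size_neq0// scale1r.
Qed.

Lemma mean_near s z c : s != [::] ->
  (forall v, v \in s -> `|v - z| <= c) -> `|mean s - z| <= c.
Proof.
move=> s0 sc; rewrite mean_subr// normrZ ger0_norm ?invr_ge0//.
rewrite ler_pdivrMl ?lt0r ?size_neq0 ?ler0n//.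
rewrite (le_trans (ler_norm_sum _ _ _))// mulr_natl -[leRHS]iter_addr_0.
rewrite -count_predT -big_const_seq big_seq [leRHS]big_seq.
by apply: ler_sum => v /sc.
Qed.

(** One of the terms in the average of the [w - v] is zero, hence the factor
    smaller than one. *)
Lemma mean_vertex_near n s D v : (size s <= n.+1)%N ->
  {in s &, forall w w', `|w - w'| <= D} -> v \in s ->
  `|mean s - v| <= n%:R / n.+1%:R * D.
Proof.
move=> sn sD vs; have s0 : s != [::] by case: s vs {sn sD}.
have D0 : 0 <= D by exact: le_trans (normr_ge0 _) (sD v v vs vs).
rewrite mean_subr// (perm_big _ (perm_to_rem vs)) big_cons /= subrr add0r.
rewrite normrZ ger0_norm ?invr_ge0//.
case E : (size s) => [|k]; first by move/eqP: E; rewrite size_eq0 (negbTE s0).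
have srem : size (rem v s) = k by rewrite size_rem// E.
apply: (@le_trans _ _ (k.+1%:R^-1 * (k%:R * D))).
  rewrite ler_wpM2l ?invr_ge0// (le_trans (ler_norm_sum _ _ _))//.
  rewrite mulr_natl -[leRHS]iter_addr_0 -srem -count_predT -big_const_seq.
  rewrite big_seq [leRHS]big_seq; apply: ler_sum => w /mem_rem ws; exact: sD.
rewrite mulrA ler_wpM2r// ler_pdivlMr// -mulrA ler_pdivrMl//.
rewrite -!natrM ler_nat; rewrite E ltnS in sn; nia.
Qed.

Lemma subdiv_near k s t z c : size s = k ->
  (forall v, v \in s -> `|v - z| <= c) -> t \in subdiv mean k s ->
  forall v, v \in t -> `|v - z| <= c.
Proof.
move=> ss sz; apply: (@subdiv_closed _ mean (fun v => `|v - z| <= c)) => //.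
by move=> u; exact: mean_near.
Qed.

(** Barycentric subdivision in dimension at most [n] shrinks the diameters of
    simplices by the factor [n / (n + 1)]. *)
Lemma subdiv_mesh n D k s t : (k <= n.+1)%N -> size s = k ->
  {in s &, forall w w', `|w - w'| <= D} -> t \in subdiv mean k s ->
  {in t &, forall w w', `|w - w'| <= n%:R / n.+1%:R * D}.
Proof.
elim: k s t => [|k IH] s t kn ss sD; first by rewrite inE => /eqP->.
have s0 : s != [::] by rewrite -size_eq0 ss.
have D0 : 0 <= D.
  case: s s0 sD {ss} => // v s _ /(_ v v); rewrite mem_head.
  by move=> /(_ isT isT); exact: le_trans.
have q0 : 0 <= n%:R / n.+1%:R * D by rewrite !mulr_ge0// invr_ge0.
move=> /allpairsPdep[u [w [us wu ->]]].
have su : size u = k by have := size_faces us; rewrite ss => -[].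
have wP v : v \in w -> `|mean s - v| <= n%:R / n.+1%:R * D.
  move=> vw; rewrite distrC; apply: subdiv_near wu _ vw => // x /(mem_faces us) xs.
  by rewrite distrC; apply: mean_vertex_near => //; rewrite ss.
move=> x y; rewrite !inE => /orP[/eqP->|xw] /orP[/eqP->|yw].
- by rewrite subrr normr0.
- exact: wP.
- by rewrite distrC; exact: wP.
- apply: IH wu _ _ xw yw => //; first exact: ltnW.
  by move=> ? ? /(mem_faces us) + /(mem_faces us); exact: sD.
Qed.

Lemma isubdiv_mesh n r D s t : size s = n.+1 ->
  {in s &, forall w w', `|w - w'| <= D} -> t \in isubdiv mean r n.+1 s ->
  {in t &, forall w w', `|w - w'| <= (n%:R / n.+1%:R) ^+ r * D}.
Proof.
elim: r D s t => [|r IH] D s t ss sD.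
  by rewrite inE => /eqP->; rewrite expr0 mul1r.
move=> /allpairsPdep[u [w [us wu ->]]]; rewrite exprSr -mulrA.
apply: IH wu; first exact: size_subdiv us.
exact: subdiv_mesh us.
Qed.

End mesh.

(** * The Knaster-Kuratowski-Mazurkiewicz theorem *)

Section simplex.
Context {R : realType}.

(** The standard simplex, of dimension [n - 1]. *)
Definition simplex n : set 'rV[R]_n :=
  [set x | (forall i, 0 <= x 0 i) /\ \sum_i x 0 i = 1].

Lemma simplex_le1 n (x : 'rV[R]_n) i : simplex x -> x 0 i <= 1.
Proof.
by move=> [x0 <-]; rewrite (bigD1 i)//= lerDl sumr_ge0.
Qed.

Lemma closed_coord_eq0 n (i : 'I_n) : closed [set x : 'rV[R]_n | x 0 i = 0].
Proof.
apply: (@preimage_closed _ _ (fun x : 'rV[R]_n => x 0 i) [set 0]).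
  by move=> x _; exact: coord_continuous.
exact: closed_eq.
Qed.

Lemma compact_simplex n : compact (@simplex n).
Proof.
have cube : compact [set x : 'rV[R]_n | forall i, `[(0 : R), 1]%classic (x ord0 i)].
  by apply: (@rV_compact _ _ (fun=> `[(0 : R), 1]%classic)) => _;
    exact: segment_compact.
apply: (subclosed_compact _ cube).
- have -> : @simplex n =
      \bigcap_i [set x : 'rV[R]_n | 0 <= x 0 i] `&`
      (fun x : 'rV[R]_n => \sum_i x 0 i) @^-1` [set 1].
    apply/seteqP; split=> x [x0 x1]; split=> // i; [move=> _|]; exact: x0.
  apply: closedI.
    apply: closed_bigI => i _.
    apply: (@preimage_closed _ _ (fun x : 'rV[R]_n => x 0 i) [set y | 0 <= y]).
      by move=> x _; exact: coord_continuous.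
    exact: closed_ge.
  apply: preimage_closed; last exact: closed_eq.
  move=> x _; apply: continuous_big => [|i _]; first exact: add_continuous.
  exact: coord_continuous.
- move=> x sx i /=; rewrite in_itv/= simplex_le1// andbT; exact: sx.1.
Qed.

Lemma lebesgue_number (T : pseudoMetricType R) (I : Type) (K : set T)
    (G : I -> set T) : compact K -> (forall i, open (G i)) ->
  K `<=` \bigcup_i G i ->
  exists2 d : R, 0 < d & forall x, K x -> exists i, ball x d `<=` G i.
Proof.
move=> /compact_near_coveringP cK oG KG.
pose P (d : R) (x : T) := exists i, ball x d `<=` G i.
have : \forall d \near (0 : R)^'+, K `<=` P d.
  apply: cK => x /KG[i _ Gx].
  have /nbhs_ballP[e /= e0 eG] : nbhs x (G i) by exact: open_nbhs_nbhs.
  have e2 : 0 < e / 2 by rewrite divr_gt0.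
  exists (ball x (e / 2), [set d | d < e / 2]) => /=.
    by split; [exact: nbhsx_ballx|exact: nbhs_right_lt].
  move=> [y d] /= [xy de]; exists i => z yz; apply: eG.
  rewrite (splitr e); apply: ball_triangle xy _.
  exact: le_ball (ltW de) _ yz.
move=> h; have : \forall d \near (0 : R)^'+, 0 < d /\ K `<=` P d.
  by apply: filterS2 (nbhs_right_gt 0) h.
by move=> /filter_ex[d [d0 dK]]; exists d.
Qed.

Lemma simplex_mean n (t : seq 'rV[R]_n) : t != [::] ->
  (forall v, v \in t -> simplex v) -> simplex (mean t).
Proof.
move=> t0 tS; have s0 : (size t)%:R != 0 :> R by rewrite pnatr_eq0 size_eq0.
split=> [i|].
  rewrite /mean !mxE summxE mulr_ge0 ?invr_ge0// big_seq sumr_ge0// => v /tS.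
  by case.
under eq_bigr do rewrite /mean !mxE summxE.
rewrite -mulr_sumr exchange_big/= big_seq.
under eq_bigr => v /tS[_ ->] do over.
by rewrite -big_seq big_const_seq count_predT iter_addr_0 mulVf.
Qed.

Lemma face_mean n (t : seq 'rV[R]_n) (i : 'I_n) :
  (forall v, v \in t -> v 0 i = 0) -> (mean t) 0 i = 0.
Proof.
move=> t0; rewrite /mean !mxE summxE big_seq big1 ?mulr0// => v; exact: t0.
Qed.

(** The Knaster-Kuratowski-Mazurkiewicz theorem for open sets. Label a point
    [x] by some [i] such that the ball of radius [d] around [x] lies in [G i],
    where [d] is a Lebesgue number of the cover. A simplex of diameter smaller
    than [d] with all the labels has its vertices in every [G i]. *)
Lemma kkm_open n (G : 'I_n.+1 -> set 'rV[R]_n.+1) :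
  (forall i, open (G i)) -> @simplex n.+1 `<=` \bigcup_i G i ->
  (forall i x, simplex x -> G i x -> x 0 i != 0) ->
  exists2 x, simplex x & forall i, G i x.
Proof.
move=> oG SG G0.
have [d d0 dG] := lebesgue_number (@compact_simplex n.+1) oG SG.
have /choice[l lG] (x : 'rV[R]_n.+1) :
    exists i, simplex x -> ball x d `<=` G i.
  by have [/dG[i]|] := pselect (simplex x); [exists i|exists ord0].
(* the vertices of the simplex and, for [k <= n], the face opposite to the
   [k]-th of them *)
pose e j : 'rV[R]_n.+1 := \row_i (i == j :> nat)%:R.
pose Z (k : nat) (x : 'rV[R]_n.+1) := forall i : 'I_n.+1, i = k :> nat -> x 0 i = 0.
have eS j : (j < n.+1)%N -> simplex (e j).
  move=> jn; split=> [i|]; first by rewrite mxE ler0n.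
  rewrite (bigD1 (Ordinal jn))//= mxE eqxx big1 ?addr0// => i /negbTE ij.
  by rewrite mxE; move: ij; rewrite -val_eqE/= => ->.
have eZ i j : (j < n.+1)%N -> i != j -> Z i (e j).
  by move=> _ ij k ki; rewrite mxE ki (negbTE ij).
have lZ x : simplex x -> ~ Z (l x : nat) x.
  move=> xS /(_ (l x) erefl) x0; have := @G0 (l x) x xS.
  by rewrite x0 eqxx => /(_ (lG x xS _ (ballxx _ d0))).
have Zm i t : t != [::] -> (forall v, v \in t -> Z i v) -> Z i (mean t).
  by move=> _ tZ k ki; apply: face_mean => v vt; exact: tZ vt k ki.
pose s := map e (iota 0 n.+1).
have [r rd] : exists r, (n%:R / n.+1%:R) ^+ r * 1 < d.
  have q1 : `|n%:R / n.+1%:R : R| < 1.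
    by rewrite ger0_norm ?divr_ge0// ltr_pdivrMr// mul1r ltr_nat.
  have h : \forall r \near \oo, (n%:R / n.+1%:R : R) ^+ r < d.
    exact: (cvgr_lt _ (cvg_expr q1) _ d0).
  by have [r rd] := filter_ex h; exists r; rewrite mulr1.
have [t ts tl] := sperner (@simplex_mean n.+1) Zm eS eZ lZ r.
have sS : size s = n.+1 by rewrite size_map size_iota.
have s1 : {in s &, forall w w', `|w - w'| <= 1}.
  move=> _ _ /mapP[j _ ->] /mapP[k _ ->].
  rewrite /Num.norm/= mx_normrE; apply/bigmax_leP; split => // -[a i] _ /=.
  rewrite !mxE ler_norml; case: eqP; case: eqP => _ _ /=; lra.
have tm := isubdiv_mesh sS s1 ts.
have tS v : v \in t -> simplex v.
  apply: (isubdiv_closed (@simplex_mean n.+1) sS _ ts) => _ /mapP[j + ->].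
  by rewrite mem_iota => /andP[_]; exact: eS.
have lt (i : 'I_n.+1) : exists2 v, v \in t & l v = i.
  have : (i : nat) \in map (fun v => l v : nat) t.
    by rewrite (perm_mem tl) mem_iota/=.
  by move=> /mapP[v vt iE]; exists v => //; exact/val_inj.
have [v vt _] := lt ord0; exists v; first exact: tS.
move=> i; have [w wt <-] := lt i; apply: (lG w (tS w wt)).
by rewrite -ball_normE/=; apply: le_lt_trans rd; exact: tm.
Qed.

End simplex.

(** * Continuous families of ultrametric spaces *)

Lemma dist_max_le (R : realDomainType) (a b c d e : R) :
  `|a - c| <= e -> `|b - d| <= e -> `|Num.max a b - Num.max c d| <= e.
Proof.
rewrite !ler_norml => /andP[h1 h2] /andP[h3 h4].
by case: (leP a b) => ab; case: (leP c d) => cd; apply/andP; split; lra.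
Qed.

Section gh.
Context {R : realType}.
Implicit Types X Y : compactMetric R.

(** Two compact metric spaces parametrized by the same set, so that the distances
    differ by at most [e], are at Gromov-Hausdorff distance at most [e]. The
    proof glues them along the infimum of the lengths of the paths that cross
    from [f w] to [g w] for some [w], a crossing having length [e / 2]. *)
Lemma gh_dist_correspondence (W : Type) X Y (f : W -> X) (g : W -> Y) (e : R) :
  0 < e -> range f = setT -> range g = setT ->
  (forall w w', `|mdist (f w) (f w') - mdist (g w) (g w')| <= e) ->
  gh_dist X Y <= e.
Proof.
move=> e0 fT gT fg.
have [w0 _] : exists w : W, True.
  have [x0 _] := cm_nonempty X.
  by have : range f x0 by [rewrite fT]; move=> [w _ _]; exists w.
pose S x y := [set mdist x (f w) + mdist (g w) y | w in [set: W]].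
have S0 x y : S x y !=set0 by exists (mdist x (f w0) + mdist (g w0) y), w0.
have Sge x y w : inf (S x y) <= mdist x (f w) + mdist (g w) y.
  apply: ge_inf; last by exists w.
  by exists 0 => _ [w' _ <-]; rewrite addr_ge0 ?mdist_ge0.
have Sinf x y (r : R) : (forall w, r <= mdist x (f w) + mdist (g w) y) ->
    r <= inf (S x y).
  by move=> h; apply: lb_le_inf => // _ [w _ <-].
have tr := @metric_triangle R.
have e2 : 0 < e / 2 by rewrite divr_gt0.
(* two elements of [W] bound the distance between the points that they link *)
have link x x' y y' w w' :
    mdist x x' <= mdist x (f w) + mdist (g w) y + mdist y y' +
      (mdist x' (f w') + mdist (g w') y') + e /\
    mdist y y' <= mdist x (f w) + mdist (g w) y + mdist x x' +
      (mdist x' (f w') + mdist (g w') y') + e.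
  have := fg w w'; rewrite ler_norml => /andP[h1 h2]; split.
    have := tr _ x (f w) x'; have := tr _ (f w) (f w') x'.
    have := tr _ (g w) y (g w'); have := tr _ y y' (g w').
    by rewrite (metric_sym (f w') x') (metric_sym y' (g w')); lra.
  have := tr _ y (g w) y'; have := tr _ (g w) (g w') y'.
  have := tr _ (f w) x (f w'); have := tr _ x x' (f w').
  by rewrite (metric_sym y (g w)) (metric_sym (f w) x); lra.
pose c x y := e / 2 + inf (S x y).
have cle x y (r : R) : (forall w, r <= mdist x (f w) + mdist (g w) y + e / 2) ->
    r <= c x y.
  by move=> h; rewrite /c -lerBlDl; apply: Sinf => w; rewrite lerBlDr.
have [|x x' y|x y y'|x x' y|x y y'|Z [a [b [aemb bemb ab]]]] := @metric_glue R X Y c.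
- by move=> x y; rewrite /c ltr_wpDr// Sinf// => w; rewrite addr_ge0 ?mdist_ge0.
- rewrite -lerBlDl; apply: (cle) => w; have := Sge x y w; have := tr _ x x' (f w).
  by rewrite /c; lra.
- rewrite -lerBlDr; apply: (cle) => w; have := Sge x y w; have := tr _ (g w) y' y.
  by rewrite /c; lra.
- rewrite -lerBlDr; apply: (cle) => w; rewrite lerBlDr addrC -lerBlDr.
  apply: (cle) => w'.
  by have [] := link x x' y y w w'; rewrite mdistxx; lra.
- rewrite -lerBlDr; apply: (cle) => w; rewrite lerBlDr addrC -lerBlDr.
  apply: (cle) => w'.
  by have [] := link x x y y' w w'; rewrite mdistxx; lra.
have abe w : mdist (a (f w)) (b (g w)) <= e.
  by rewrite ab /c; have := Sge (f w) (g w) w; rewrite !mdistxx; lra.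
apply: (gh_dist_le aemb bemb) => [x|y].
- by have : range f x by [rewrite fT]; move=> [w _ <-]; exists (g w).
- by have : range g y by [rewrite gT]; move=> [w _ <-]; exists (f w).
Qed.

Lemma pi_ghSpace_eq X Y : (forall e : R, 0 < e -> gh_dist X Y <= e) ->
  \pi_(ghSpace R) X = \pi_(ghSpace R) Y.
Proof.
move=> h; apply/pi_ghSpaceP/gh_dist0_isometric/eqP.
rewrite eq_le gh_dist_ge0 andbT; apply/ler_addgt0Pl => e e0.
by rewrite addr0 h.
Qed.

(** The isometry class of an ultrametric space, as a point of the subspace of
    ultrametric classes. *)
Definition ultrametric_class X (uX : ultrametric X) :
  set_type (@ultrametric_classes R) :=
  SigSub (mem_set (ex_intro2 _ _ X uX erefl) :
    \pi_(ghSpace R) X \in @ultrametric_classes R).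

Lemma continuous_ultrametric_class (T : topologicalType) (p : T -> compactMetric R)
    (up : forall t, ultrametric (p t)) :
  (forall t e, 0 < e -> \forall s \near t, gh_dist (p t) (p s) <= e) ->
  continuous (fun t => ultrametric_class (up t)).
Proof.
move=> cp; apply: continuous_comp_initial => t.
apply/cvg_ballP => e e0; have e2 : 0 < e / 2 by rewrite divr_gt0.
apply: filterS (cp t _ e2) => s.
rewrite ballEmdist/= mdist_pi => /le_lt_trans; apply.
by rewrite gtr_pMr// invf_lt1// ltr1n.
Qed.

End gh.

(** * Paths between ultrametric spaces *)

Section weighted_product.
Context {R : realType} (X Y : compactMetric R).
Hypotheses (uX : ultrametric X) (uY : ultrametric Y).

(** The larger of the distances between the two coordinates, scaled by [a] and
    [b]. *)
Definition weighted_dist (a b : R) (u v : X * Y) : R :=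
  Num.max (a * mdist u.1 v.1) (b * mdist u.2 v.2).

Lemma weighted_dist_ge0 a b u v : 0 <= a -> 0 <= weighted_dist a b u v.
Proof. by move=> a0; rewrite le_max mulr_ge0 ?mdist_ge0. Qed.

Lemma weighted_dist_ultra a b u v w : 0 <= a -> 0 <= b ->
  weighted_dist a b u v <= Num.max (weighted_dist a b u w) (weighted_dist a b w v).
Proof.
move=> a0 b0; rewrite /weighted_dist maxACA -!maxr_pMr//.
by rewrite ge_max !le_max; apply/andP; split; apply/orP; [left|right];
  rewrite ler_wpM2l// ?uX ?uY.
Qed.

Lemma weighted_product (a b : R) : 0 < a -> 0 < b ->
  exists (Z : compactMetric R) (f : X * Y -> Z),
    [/\ ultrametric Z, range f = setT &
        forall u v, mdist (f u) (f v) = weighted_dist a b u v].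
Proof.
move=> a0 b0; pose d := weighted_dist a b.
have dxx u : d u u = 0 by rewrite /d /weighted_dist !mdistxx !mulr0 maxxx.
have dp u v : d u v = 0 -> u = v.
  case: u v => [x y] [x' y'] /eqP; rewrite eq_le ge_max/= !pmulr_rle0//.
  move=> /andP[/andP[xx yy] _].
  by congr (_, _); apply: mdist_positivity; apply/eqP; rewrite eq_le mdist_ge0 andbT.
have ds u v : d u v = d v u by rewrite /d /weighted_dist metric_sym (metric_sym u.2).
have du w u v := weighted_dist_ultra u v w (ltW a0) (ltW b0).
have dt w u v : d u v <= d u w + d w v.
  apply: le_trans (du w u v) _.
  by rewrite ge_max lerDl lerDr !weighted_dist_ge0// ltW.
pose Z := MetricSpace dxx dp ds dt.
have cZ : compact [set: Z].
  have -> : [set: Z] = (id : X * Y -> Z) @` ([set: X] `*` [set: Y]).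
    by apply/seteqP; split=> // z _; exists z.
  apply: continuous_compact; last by apply: compact_setX; exact: cm_compact.
  apply: continuous_subspaceT => -[x y]; apply/cvg_ballP => e e0.
  exists (ball x (e / a), ball y (e / b)) => /=.
    by split; apply: nbhsx_ballx; rewrite divr_gt0.
  move=> [x' y'] [] /=; rewrite !ballEmdist/= => xx yy.
  rewrite /mdist/= /d /weighted_dist/= gt_max !(mulrC _ (mdist _ _)).
  by rewrite -!ltr_pdivlMr// xx.
have nZ : [set: Z] !=set0.
  by have [x _] := cm_nonempty X; have [y _] := cm_nonempty Y; exists (x, y).
exists (CompactMetric cZ nZ), id; split; last by [].
  by move=> u v w; exact: du.
exact: image_id.
Qed.

End weighted_product.

Section path.
Context {R : realType} (X Y : compactMetric R).
Hypotheses (uX : ultrametric X) (uY : ultrametric Y).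

(** The spaces on a path from [X] to [Y]: the product with weights [1 - t] and
    [t], which collapses to [X] for [t = 0] and to [Y] for [t = 1]. Absolute
    values make the family defined for all real [t]; each space comes with a
    parametrization by [X * Y]. *)
Lemma ultrametric_interpolation (t : R) : exists Z : {Z : compactMetric R & X * Y -> Z},
  [/\ ultrametric (projT1 Z), range (projT2 Z) = setT &
      forall u v, mdist (projT2 Z u) (projT2 Z v) =
                  weighted_dist `|1 - t| `|t| u v].
Proof.
have [x0 _] := cm_nonempty X; have [y0 _] := cm_nonempty Y.
have [->|t0] := eqVneq t 0.
  exists (existT _ X fst); split=> //=.
    by apply/seteqP; split=> // x _; exists (x, y0).
  move=> u v; rewrite /weighted_dist subr0 normr1 normr0 mul1r mul0r.
  by rewrite max_l// mdist_ge0.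
have [->|t1] := eqVneq t 1.
  exists (existT _ Y snd); split=> //=.
    by apply/seteqP; split=> // y _; exists (x0, y).
  move=> u v; rewrite /weighted_dist subrr normr1 normr0 mul1r mul0r.
  by rewrite max_r// mdist_ge0.
have [||Z [f [uZ fT fd]]] := weighted_product uX uY (a := `|1 - t|) (b := `|t|).
- by rewrite normr_gt0 subr_eq0 eq_sym.
- by rewrite normr_gt0.
by exists (existT _ Z f).
Qed.

Let Zf t := projT1 (cid (ultrametric_interpolation t)).
Let Z t : compactMetric R := projT1 (Zf t).

Let uZ t : ultrametric (Z t).
Proof. by have [] := projT2 (cid (ultrametric_interpolation t)). Qed.

Lemma weighted_dist_lipschitz : exists2 M : R, 0 < M &
  forall (s t : R) (u v : X * Y),
  `|weighted_dist `|1 - s| `|s| u v - weighted_dist `|1 - t| `|t| u v| <=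
  `|s - t| * M.
Proof.
have [M hM] := cm_bounded X; have [N hN] := cm_bounded Y.
exists (1 + `|M| + `|N|) => [|s t u v].
  by rewrite -addrA ltr_pwDl// addr_ge0.
have bX : mdist u.1 v.1 <= 1 + `|M| + `|N|.
  by have := hM u.1 v.1; have := ler_norm M; have := normr_ge0 N; lra.
have bY : mdist u.2 v.2 <= 1 + `|M| + `|N|.
  by have := hN u.2 v.2; have := ler_norm N; have := normr_ge0 M; lra.
apply: dist_max_le; rewrite -mulrBl normrM (ger0_norm (mdist_ge0 _ _)).
  apply: ler_pM => //; rewrite ?mdist_ge0// (le_trans (ler_dist_dist _ _))//.
  by rewrite opprB addrC addrA subrK distrC.
by apply: ler_pM => //; rewrite ?mdist_ge0// ler_dist_dist.
Qed.

Let Z_near t (e : R) : 0 < e -> \forall s \near t, gh_dist (Z t) (Z s) <= e.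
Proof.
move=> e0; have [M M0 hM] := weighted_dist_lipschitz.
have eM : 0 < e / M by rewrite divr_gt0.
apply: filterS (nbhsx_ballx t _ eM) => s.
rewrite -ball_normE/= ltr_pdivlMr// => ts.
have [_ sT sd] := projT2 (cid (ultrametric_interpolation s)).
have [_ tT td] := projT2 (cid (ultrametric_interpolation t)).
apply: (gh_dist_correspondence e0 tT sT) => u v.
by rewrite td sd (le_trans (hM _ _ _ _))// ltW.
Qed.

Lemma ultrametric_class_path :
  squashed {path unit_interval R from ultrametric_class uX to ultrametric_class uY
            in set_type (@ultrametric_classes R)}.
Proof.
pose Phi (t : unit_interval R) := ultrametric_class (@uZ (val t)).
have cPhi : continuous Phi.
  move=> t; apply: (@continuous_comp _ _ _ (fun t : unit_interval R => val t)
      (fun t => ultrametric_class (@uZ t))).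
    exact: initial_continuous.
  exact: (@continuous_ultrametric_class R _ Z uZ Z_near).
(* at the ends of the path, the space is only known to have the distances of
   [X] or [Y], which determine its class *)
have classE (A : compactMetric R) (uA : ultrametric A) t (f : X * Y -> A) :
    range f = setT ->
    (forall u v, mdist (f u) (f v) = weighted_dist `|1 - t| `|t| u v) ->
    ultrametric_class (@uZ t) = ultrametric_class uA.
  move=> fT fd; apply/val_inj/pi_ghSpace_eq => e e0.
  have [_ tT td] := projT2 (cid (ultrametric_interpolation t)).
  apply: (gh_dist_correspondence e0 tT fT) => u v.
  by rewrite td fd subrr normr0 ltW.
have [x0 _] := cm_nonempty X; have [y0 _] := cm_nonempty Y.
have Phi0 : Phi zero = ultrametric_class uX.
  apply: (classE _ _ _ fst).
    by apply/seteqP; split=> // x _; exists (x, y0).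
  move=> u v; rewrite /weighted_dist/= subr0 normr1 normr0 mul1r mul0r.
  by rewrite max_l// mdist_ge0.
have Phi1 : Phi one = ultrametric_class uY.
  apply: (classE _ _ _ snd).
    by apply/seteqP; split=> // y _; exists (x0, y).
  move=> u v; rewrite /weighted_dist/= subrr normr1 normr0 mul1r mul0r.
  by rewrite max_r// mdist_ge0.
exact: squash (mk_path cPhi Phi0 Phi1 : {path _ from _ to _ in _}).
Qed.

End path.

Lemma path_connected_ultrametric_classes (R : realType) :
  path_connected R (set_type (@ultrametric_classes R)).
Proof.
have h (x : set_type (@ultrametric_classes R)) :
    exists (X : compactMetric R) (uX : ultrametric X), x = ultrametric_class uX.
  have [X uX Xx] := set_mem (valP x).
  by exists X, uX; apply/val_inj; rewrite /= Xx.
move=> x y; have [X [uX ->]] := h x; have [Y [uY ->]] := h y.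
exact: ultrametric_class_path.
Qed.

(** * A simplex of finite ultrametric spaces *)

Section star.
Context {R : realType} (n : nat).
Implicit Types (x y : 'rV[R]_n.+1) (u v w : nat).

(** The weight of the point [k + 1] lies in the interval from [2 k + 1] to
    [2 k + 2] if [x] has coordinates of absolute value at most one, so that
    the weights determine [x] up to signs; the point [0] has weight zero. *)
Definition weight x u : R :=
  if u is k.+1 then 2 * k%:R + 1 + `|x 0 (inord k)| else 0.

(** Distinct points are at distance the larger of their weights. *)
Definition star_dist x u v : R :=
  if u == v then 0 else Num.max (weight x u) (weight x v).

Lemma weight_gt0 x k : 0 < weight x k.+1.
Proof. by rewrite /= -addrA ltr_wpDl// ?mulr_ge0// ltr_pwDl. Qed.

Lemma weight_ge0 x u : 0 <= weight x u.
Proof. by case: u => [//|k]; exact/ltW/weight_gt0. Qed.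

Lemma star_distxx x u : star_dist x u u = 0.
Proof. by rewrite /star_dist eqxx. Qed.

Lemma star_dist_ge0 x u v : 0 <= star_dist x u v.
Proof. by rewrite /star_dist; case: ifP => // _; rewrite le_max weight_ge0. Qed.

Lemma star_dist_positivity x u v : star_dist x u v = 0 -> u = v.
Proof.
rewrite /star_dist; case: eqP => // uv /eqP; rewrite eq_le ge_max -andbA.
case: u v uv => [|k] [|l] // _ /and3P[h1 h2 _].
- by move: h2; rewrite leNgt weight_gt0.
- by move: h1; rewrite leNgt weight_gt0.
- by move: h1; rewrite leNgt weight_gt0.
Qed.

Lemma star_dist_weight x u v : star_dist x u v != 0 ->
  exists2 k, k.+1 = u \/ k.+1 = v & star_dist x u v = weight x k.+1.
Proof.
rewrite /star_dist; case: (u =P v) => [_|uv]; first by rewrite eqxx.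
rewrite /Order.max; case: ifP => _.
  by case: v {uv} => [|k]; [rewrite eqxx|exists k => //; right].
by case: u {uv} => [|k]; [rewrite eqxx|exists k => //; left].
Qed.

Lemma star_dist_sym x u v : star_dist x u v = star_dist x v u.
Proof. by rewrite /star_dist eq_sym maxC. Qed.

Lemma star_dist_ultra x u v w :
  star_dist x u v <= Num.max (star_dist x u w) (star_dist x w v).
Proof.
have [->|uw] := eqVneq u w; first by rewrite le_max lexx orbT.
have [->|wv] := eqVneq w v; first by rewrite le_max lexx.
rewrite /star_dist (negbTE uw) (negbTE wv); case: ifP => _.
  by rewrite !le_max weight_ge0.
by rewrite ge_max !le_max !lexx !orbT.
Qed.

Lemma star_dist_triangle x w u v :
  star_dist x u v <= star_dist x u w + star_dist x w v.
Proof.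
by rewrite (le_trans (star_dist_ultra x u v w))// ge_max lerDl lerDr !star_dist_ge0.
Qed.

(** The carrier of the finite ultrametric spaces. It is a subtype of [nat],
    rather than an ordinal type, because it has to live in the small universe
    of the carriers of [metricSpace]. *)
Definition star_point : Type := {u : nat | (u < n.+2)%N}.

Lemma star_point_dist_positivity x (p q : star_point) :
  star_dist x (val p) (val q) = 0 -> p = q.
Proof. by move=> /star_dist_positivity/val_inj. Qed.

Definition star_metric x : metricSpace R :=
  @MetricSpace R star_point (fun p q => star_dist x (val p) (val q))
    (fun p => star_distxx x (val p)) (@star_point_dist_positivity x)
    (fun p q => star_dist_sym x (val p) (val q))
    (fun r p q => star_dist_triangle x (val r) (val p) (val q)).

Lemma star_compact x : compact [set: star_metric x].
Proof.
apply: finite_compact.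
have -> : [set: star_metric x] =
    (fun i : 'I_n.+2 => exist _ (val i) (ltn_ord i) : star_metric x) @` setT.
  apply/seteqP; split=> // -[u un] _; exists (Ordinal un) => //.
  exact/val_inj.
exact/finite_image/finite_finset.
Qed.

Definition star_origin : star_point := exist _ 0%N isT.

(** The family of finite ultrametric spaces parametrized by vectors. *)
Definition star_space x : compactMetric R := CompactMetric (@star_compact x)
  (ex_intro _ star_origin I : [set: star_metric x] !=set0).

Lemma star_space_ultrametric x : ultrametric (star_space x).
Proof. by move=> u v w; exact: star_dist_ultra. Qed.

Lemma star_space_near x (e : R) : 0 < e ->
  \forall y \near x, gh_dist (star_space x) (star_space y) <= e.
Proof.
move=> e0; apply: filterS (nbhsx_ballx x _ e0) => y [_ xy].
apply: (@gh_dist_correspondence _ star_point (star_space x) (star_space y) id id);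
  [exact: e0|exact: image_id|exact: image_id|].
have we u : `|weight x u - weight y u| <= e.
  case: u => [|k] /=; first by rewrite subrr normr0 ltW.
  rewrite opprD addrACA subrr add0r (le_trans (ler_dist_dist _ _))//.
  by apply: ltW; have := xy 0 (inord k); rewrite -ball_normE.
move=> [u ?] [v ?]; rewrite -[mdist _ _]/(star_dist x u v).
rewrite -[X in _ - X]/(star_dist y u v).
rewrite /star_dist; case: ifP => _; first by rewrite subrr normr0 ltW.
exact: dist_max_le.
Qed.

Definition star_class x : set_type (@ultrametric_classes R) :=
  ultrametric_class (@star_space_ultrametric x).

Lemma continuous_star_class : continuous star_class.
Proof. exact/continuous_ultrametric_class/star_space_near. Qed.

(** The nonzero distances are the weights of the points other than [0]; they
    form an isometry invariant, from which the coordinates are recovered. *)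
Lemma star_class_inj x y : simplex x -> simplex y ->
  star_class x = star_class y -> x = y.
Proof.
move=> xS yS /(congr1 val)/pi_ghSpaceP[f _ fi].
apply/rowP => k.
pose p : star_point := exist _ (k : nat).+1 (ltn_ord k : k.+1 < n.+2)%N.
have fd q r : star_dist y (val (f q)) (val (f r)) = star_dist x (val q) (val r).
  exact: fi.
have [l ln lE] : exists2 l, (l < n.+1)%N & weight x k.+1 = weight y l.+1.
  have wp : star_dist x (val star_origin) (val p) = weight x k.+1.
    by rewrite /star_dist/= max_r//; exact: (@weight_ge0 x k.+1).
  rewrite -wp -fd.
  have [|l lfp ->] := @star_dist_weight y (val (f star_origin)) (val (f p)).
    by rewrite fd wp gt_eqF// weight_gt0.
  exists l => //; have := valP (f star_origin); have := valP (f p).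
  by case: lfp => <-.
move: lE; rewrite /= inord_val (ger0_norm (xS.1 k)) (ger0_norm (yS.1 (inord l))).
have := simplex_le1 k xS; have := simplex_le1 (inord l) yS.
have := xS.1 k; have := yS.1 (inord l) => y0 x0 y1 x1 h.
suff kl : k = l :> nat by move: h; rewrite -kl inord_val; lra.
apply/eqP; rewrite eqn_leq; apply/andP; split.
  by rewrite -ltnS -(ltr_nat R) -natr1; lra.
by rewrite -ltnS -(ltr_nat R) -natr1; lra.
Qed.

End star.

(** * The theorem *)

(** If the dimension were at most [n], take the cover of the space of classes by
    the complements [W i] of the images of the facets of the simplex with
    [n + 2] vertices. Merging the members of a refinement according to the
    [W i] that contains them, and pulling back to the simplex, [kkm_open] gives
    a point in [n + 2] distinct members. *)
Lemma infinite_dimensional_ultrametric_classes (R : realType) :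
  infinite_dimensional (set_type (@ultrametric_classes R)).
Proof.
move=> n dimn; set T := set_type _ in dimn.
pose phi : 'rV[R]_n.+2 -> T := @star_class R n.+1.
have cphi : continuous phi by exact: continuous_star_class.
pose F (i : 'I_n.+2) := @simplex R n.+2 `&` [set x | x 0 i = 0].
pose W (i : 'I_n.+2) : set T := ~` (phi @` F i).
have oW i : open (W i).
  have -> : W i = set_val @^-1` (~` ((set_val \o phi) @` F i)).
    apply/seteqP; split=> t /= Wt [x Fx xt]; apply: Wt.
      by exists x => //; exact/val_inj.
    by exists x => //; rewrite -xt.
  apply: open_comp; first by move=> t _; exact: initial_continuous.
  apply: closed_openC; apply: (@compact_closed (ghSpace R)).
    exact: (@metric_hausdorff R (ghSpace R)).
  apply: continuous_compact.
    apply: continuous_subspaceT => x; apply: continuous_comp; first exact: cphi.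
    exact: initial_continuous.
  apply: (subclosed_compact _ (@compact_simplex R n.+2)); last exact: subIsetl.
  apply: closedI; last exact: closed_coord_eq0.
  by apply: compact_closed; [exact: norm_hausdorff|exact: compact_simplex].
have phiW x i : simplex x -> W i (phi x) -> x 0 i != 0.
  by move=> xS; apply: contra_notN => /eqP xi; exists x.
have WT : \bigcup_i W i = [set: T].
  apply/seteqP; split=> // t _.
  have [[x xS <-]|nt] := pselect ((phi @` @simplex R n.+2) t).
    have [i xi] : exists i, x 0 i != 0.
      apply/not_existsP => x0; have := xS.2; rewrite big1 => [/eqP|i _].
        by rewrite eq_sym oner_eq0.
      by apply/eqP/negPn/negP.
    exists i => // -[y [yS /= yi]] /(star_class_inj yS xS) yx.
    by move: xi; rewrite -yx yi eqxx.
  by exists ord0 => // -[x [xS _] xt]; apply: nt; exists x.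
have [J [V [[oV VT] /choice[f Vf] cardV]]] := dimn _ W (conj oW WT).
pose G (i : 'I_n.+2) := phi @^-1` (\bigcup_(j in [set j | f j = i]) V j).
have [||i x xS [j /= <- Vx]|x xS xG] := @kkm_open R n.+1 G.
- move=> i; apply: open_comp; first by move=> x _; exact: cphi.
  by apply: bigcup_open => j _; exact: oV.
- move=> x xS; have [j _ Vx] : (\bigcup_j V j) (phi x) by rewrite VT.
  by exists (f j) => //; exists j.
- by apply: phiW xS _; exact: Vf Vx.
have /choice[g gP] i : exists j, f j = i /\ V j (phi x).
  by have [j] := xG i; exists j.
have g_inj : injective g by move=> i i' gE; rewrite -(gP i).1 gE (gP i').1.
suff : (#|codom g| <= #|[set j | `[< V j (phi x) >]]%SET|)%N.
  by rewrite (card_codom g_inj) card_ord => /leq_trans/(_ (cardV _)); rewrite ltnn.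
apply: subset_leq_card; apply/fintype.subsetP => _ /codomP[i ->].
by rewrite inE; apply/asboolP; exact: (gP i).2.
Qed.

Theorem corollary1p5 (R : realType) :
  path_connected R (set_type (@ultrametric_classes R)) /\
  infinite_dimensional (set_type (@ultrametric_classes R)).
Proof.
split; first exact: path_connected_ultrametric_classes.
exact: infinite_dimensional_ultrametric_classes.
Qed.
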